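(* Let $P_0$ be the set of all primes congruent to $3$ modulo $8$. For $n\ge1$ let $P_n$ be the set of primes $p\in P_{n-1}$ such that all prime factors of $\frac{p-1}{2}$ lie in $P_{n-1}$, and let $P_\infty=\bigcap_{n\ge0}P_n$. Then a prime $p$ divides some Nov\'ak number $N$ for which $2N$ is a Nov\'ak--Carmichael number if and only if $p\in P_\infty$.
   Context: A Nov\'ak number is a positive integer $N$ with $N\mid 2^N+1$. A positive integer $M$ is a Nov\'ak--Carmichael number if $M$ divides $a^M-1$ for every integer $a$ coprime to $M$. *)

(* Defs.v *)
From mathcomp Require Import all_boot all_order all_algebra.

Set Implicit Arguments.
Unset Strict Implicit.
Unset Printing Implicit Defensive.

Definition novak (N : nat) : Prop := 0 < N /\ N %| 2 ^ N + 1.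

Definition novak_carmichael (M : nat) : Prop :=
  0 < M /\ forall a : int, coprimez a M%:Z -> (M%:Z %| (a ^+ M - 1)%R)%Z.

Fixpoint P_ (n p : nat) {struct n} : Prop :=
  match n with
  | 0 => prime p /\ p = 3 %[mod 8]
  | m.+1 => P_ m p /\ forall q : nat, prime q -> q %| (p - 1) %/ 2 -> P_ m q
  end.

Definition P_infty (p : nat) : Prop := forall n : nat, P_ n p.

(* Main.v *)
Require Import Defs.
From mathcomp Require Import all_boot all_order all_algebra.
From mathcomp Require Import all_fingroup all_solvable zify.

(** Call [N] closed if every prime [q] dividing [N] satisfies [q = 3 %[mod 8]]
    and [(q - 1) / 2] divides [N].  Closed numbers are exactly the Novak numbers
    [N] such that [2 * N] is Novak-Carmichael.  If [2 * N] is Novak-Carmichael,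
    a primitive root modulo [q] gives [q - 1 %| 2 * N]; then [(q - 1) / 2] is
    odd, [2] has the quadratic character [-1] modulo [q] because [N] is Novak,
    and the supplementary law for [2] leaves only [q = 3 %[mod 8]].  Conversely
    Euler's theorem gives [a ^ (2 * N) = 1] modulo each prime power dividing
    [N], and [2 ^ N = -1] modulo [q] lifts to prime powers since [2 ^ N - 1] is
    then prime to [q].  Closed numbers are stable under products, so strong
    induction yields a closed multiple of any number with all prime factors in
    [P_infty]. *)

Import GRing.Theory Num.Theory.

(** * The quadratic character of 2 *)

Lemma dvdn_natFp (q n : nat) : prime q -> (q %| n) = (n%:R == 0 :> 'F_q)%R.
Proof. by move=> q_pr; rewrite (dvdn_pcharf (pchar_Fp q_pr)). Qed.

Lemma fact_odd_split (k : nat) :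
  (2 * k).+1`! = (\prod_(j < k.+1) (2 * j + 1)) * \prod_(j < k) (2 * j + 2).
Proof.
elim: k => [|k IHk]; first by rewrite big_ord_recl !big_ord0.
have -> : (2 * k.+1).+1 = (2 * k).+3 by lia.
rewrite 2!factS IHk [in RHS]big_ord_recr [X in _ = _ * X]big_ord_recr /=.
by move: (\prod_(_ < k.+1) _) (\prod_(_ < k) _) => a b; lia.
Qed.

(** The left side is the product of the even numbers [2, 4, ..., 4k+2]. The first [k] stay; the last
    [k.+1] are written as [q] minus an odd number, with [q = 4k+3]. *)
Lemma double_fact_split (k : nat) :
  2 ^ (2 * k).+1 * (2 * k).+1`! =
    (\prod_(j < k.+1) (4 * k + 3 - (2 * j + 1))) * \prod_(j < k) (2 * j + 2).
Proof.
have -> : 2 ^ (2 * k).+1 * (2 * k).+1`! = \prod_(0 <= i < (2 * k).+1) (2 * i + 2).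
  elim: (2 * k).+1 => [|n IHn]; first by rewrite big_nil.
  rewrite big_nat_recr //= -IHn expnS factS.
  by move: (2 ^ n) (n`!) => a b; lia.
rewrite (@big_cat_nat _ _ _ k) //=; last by lia.
rewrite mulnC [X in _ * X = _]big_mkord; congr (_ * _).
rewrite big_nat_rev /= -{1}[k]add0n big_addn big_mkord.
have -> : (2 * k).+1 - k = k.+1 by lia.
by apply: eq_bigr => j _; have := ltn_ord j; lia.
Qed.

(* Gauss's lemma: the even residues exceeding [q / 2] are the negatives of the
   odd residues below [q / 2], and there are [k.+1] of these. *)
Lemma euler_criterion_two (k : nat) : prime (4 * k + 3) ->
  (2 ^+ (2 * k).+1 = (-1) ^+ k.+1 :> 'F_(4 * k + 3))%R.
Proof.
set q := 4 * k + 3 => q_pr.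
have fact_neq0 : ((2 * k).+1`!%:R != 0 :> 'F_q)%R.
  rewrite -dvdn_natFp // fact_prod big_seq_cond.
  elim/big_ind: _ => [|x y hx hy|i]; first by rewrite dvdn1 /q; lia.
    by rewrite Euclid_dvdM // (negbTE hx) (negbTE hy).
  rewrite andbT mem_index_iota => hi; apply/negP => /dvdn_leq.
  by rewrite /q; lia.
apply: (mulIf fact_neq0); rewrite -natrX -natrM double_fact_split fact_odd_split.
rewrite !natrM mulrA; congr (_ * _)%R.
have -> : ((-1) ^+ k.+1 = \prod_(j < k.+1) (-1) :> 'F_q)%R.
  by rewrite prodr_const card_ord.
rewrite !natr_prod -big_split /=.
apply: eq_bigr => j _; have lt_j := ltn_ord j.
rewrite natrB ?mulN1r; last by lia.
by rewrite pchar_Fp_0 // sub0r.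
Qed.

Lemma prime_3mod8_dvd (q : nat) : prime q -> q %% 8 = 3 ->
  q %| 2 ^ ((q - 1) %/ 2) + 1.
Proof.
(* An even parameter [2 * k] makes the sign [(-1) ^ (2k+1) = -1]. *)
move=> q_pr q3; have [k qE] : exists k, q = 4 * (2 * k) + 3.
  by exists (q %/ 8); lia.
have -> : (q - 1) %/ 2 = (2 * (2 * k)).+1 by lia.
rewrite dvdn_natFp // natrD natrX; subst q.
by rewrite euler_criterion_two // exprS exprM sqrrN !expr1n mulr1 addNr.
Qed.

Lemma prime_7mod8_dvd (q : nat) : prime q -> q %% 8 = 7 ->
  q %| 2 ^ ((q - 1) %/ 2) - 1.
Proof.
move=> q_pr q7; have [k qE] : exists k, q = 4 * (2 * k).+1 + 3.
  by exists (q %/ 8); lia.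
have -> : (q - 1) %/ 2 = (2 * (2 * k).+1).+1 by lia.
rewrite dvdn_natFp // natrB ?expn_gt0 // natrX; subst q.
rewrite euler_criterion_two //; have -> : (2 * k).+2 = 2 * k.+1 by lia.
by rewrite exprM sqrrN !expr1n subrr.
Qed.

Lemma dvdn_exp_odd_succ (x k d : nat) : odd k -> d %| x + 1 -> d %| x ^ k + 1.
Proof.
case: x => [|x] k_odd dvd_d; first by move: dvd_d; rewrite dvdn1 => /eqP ->.
apply: (dvdn_trans dvd_d); rewrite -(odd_double_half k) k_odd add1n.
elim: (k./2) => [|h IHh]; first by rewrite expn1.
(* With [y = x.+1] this is [y^(n+2) + 1 = y^2 (y^n + 1) - (y+1)(y-1)]; the shift keeps [y - 1] a
   natural number. *)
have -> : x.+1 ^ (h.+1.*2).+1 + 1 =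
    x.+1 ^ 2 * (x.+1 ^ (h.*2).+1 + 1) - (x.+1 + 1) * x.
  by rewrite doubleS !expnS expn0 !muln1; move: (_ ^ _) => y; lia.
by apply: dvdn_sub; [apply: dvdn_mull | apply: dvdn_mulr].
Qed.

(** * Prime divisors of Novak-Carmichael numbers *)

Lemma dvdn_primitive_root (q n : nat) : prime q ->
  (forall a, coprime a q -> q %| a ^ n - 1) -> q - 1 %| n.
Proof.
move=> q_pr hq; have q_gt1 := prime_gt1 q_pr.
have /cyclicP[g gE] := field_unit_group_cyclic [set: {unit 'F_q}]%G.
have <- : #[g]%g = q - 1.
  by rewrite /order -gE card_finField_unit card_Fp // subn1.
rewrite order_dvdn -val_eqE /= FinRing.val_unitX.
have gu : (val g != 0)%R by rewrite -unitfE; apply: valP.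
have gnat : ((val g : nat)%:R = val g :> 'F_q)%R by rewrite natr_Zp.
have g_cop : coprime (val g : nat) q.
  by rewrite coprime_sym prime_coprime // dvdn_natFp // gnat.
have := hq _ g_cop; rewrite dvdn_natFp // natrB ?natrX ?gnat ?subr_eq0 //.
(* What remains is positivity of the power, since subtraction on [nat] truncates. *)
rewrite expn_gt0; case: n {hq} => [|n]; first by rewrite orbT.
by rewrite orbF lt0n; apply: contra gu => /eqP g0; rewrite -gnat g0.
Qed.

Lemma novak_carmichael_nat (M a : nat) : novak_carmichael M -> coprime a M ->
  M %| a ^ M - 1.
Proof.
move=> [M_gt0 hM] cop; have /hM : coprimez a%:Z M%:Z by [].
case: (posnP a) cop => [->|a_gt0] _; first by rewrite exp0n.
have -> : (a%:Z ^+ M - 1 = (a ^ M - 1)%:Z)%R.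
  by rewrite -[Posz a]natz -[Posz (_ - _)]natz natrB ?expn_gt0 ?a_gt0 // natrX.
by [].
Qed.

Lemma novak_carmichael_dvd (M q : nat) : novak_carmichael M -> prime q ->
  q %| M -> q - 1 %| M.
Proof.
move=> ncM q_pr qM; have M_gt0 : 0 < M by case: ncM.
apply: (dvdn_primitive_root _ _ q_pr) => b b_cop.
(* [b] need not be prime to [M]; it is replaced by some [a] congruent to [b] modulo [q] and to 1
   modulo the [q]-free part [r] of [M]. *)
have [r q_r ME] := pfactor_coprime q_pr M_gt0.
pose a := chinese q r b 1.
have ab : a = b %[mod q] by apply: chinese_modl.
have a1 : a = 1 %[mod r] by apply: chinese_modr.
have aM : coprime a M.
  rewrite ME coprimeMr; apply/andP; split.
    by rewrite -coprime_modl a1 coprime_modl coprime1n.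
  by apply: coprimeXr; rewrite -coprime_modl ab coprime_modl.
have b_gt0 : 0 < b.
  rewrite lt0n; apply: contraL b_cop => /eqP ->; rewrite /coprime gcd0n.
  by have := prime_gt1 q_pr; lia.
have a_gt0 : 0 < a.
  rewrite lt0n; apply: contraL aM => /eqP ->; rewrite /coprime gcd0n.
  by have := dvdn_leq M_gt0 qM; have := prime_gt1 q_pr; lia.
have := dvdn_trans qM (novak_carmichael_nat _ _ ncM aM).
rewrite -!eqn_mod_dvd ?expn_gt0 ?a_gt0 ?b_gt0 //.
by rewrite -modnXm ab modnXm.
Qed.

(** * Closed numbers and their equivalence with the Novak conditions *)

Definition closed_number (N : nat) : Prop :=
  0 < N /\ forall q, prime q -> q %| N -> q %% 8 = 3 /\ (q - 1) %/ 2 %| N.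

Lemma closed_numberM (M N : nat) : closed_number M -> closed_number N ->
  closed_number (M * N).
Proof.
move=> [M_gt0 hM] [N_gt0 hN]; split; first by rewrite muln_gt0 M_gt0.
move=> q q_pr; rewrite Euclid_dvdM // => /orP[/(hM _ q_pr)|/(hN _ q_pr)] [-> d].
  by split=> //; apply: dvdn_mulr.
by split=> //; apply: dvdn_mull.
Qed.

Lemma novak_odd (N : nat) : novak N -> odd N.
Proof.
move=> [N_gt0 dvd_N]; apply: (dvdn_odd dvd_N).
by rewrite oddD oddX /=; case: N N_gt0 {dvd_N}.
Qed.

Lemma novak_closed (N : nat) : novak N -> novak_carmichael (2 * N) ->
  closed_number N.
Proof.
move=> nN ncN; have N_odd := novak_odd _ nN; have [N_gt0 N2] := nN.
split=> // q q_pr qN; have q_odd := dvdn_odd qN N_odd.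
have q_gt1 := prime_gt1 q_pr.
have mN : (q - 1) %/ 2 %| N.
  have := novak_carmichael_dvd _ _ ncN q_pr (dvdn_mull 2 qN).
  have -> : q - 1 = 2 * ((q - 1) %/ 2) by lia.
  by rewrite dvdn_pmul2l // mulKn.
split=> //; have m_odd := dvdn_odd mN N_odd.
have [//|q7] : q %% 8 = 3 \/ q %% 8 = 7 by lia.
(* If [q = 7 %[mod 8]], then [2 ^ ((q - 1) / 2) = 1], hence [2 ^ N = 1] modulo [q]; with
   [q %| 2 ^ N + 1] this forces [q %| 2]. *)
have := prime_7mod8_dvd _ q_pr q7; have := dvdn_trans qN N2.
have /dvdnP[k ->] := mN; rewrite mulnC expnM.
move: (2 ^ _) (expn_gt0 2 ((q - 1) %/ 2)) => x /= x_gt0 qx1.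
rewrite -eqn_mod_dvd // => /eqP x1.
move: qx1; rewrite /dvdn -modnDml -modnXm x1 modnXm exp1n modnDml.
by move=> qx1; have := dvdn_leq (isT : 0 < 2) qx1; lia.
Qed.

Lemma closed_odd (N : nat) : closed_number N -> odd N.
Proof.
move=> [_ hN]; apply: contraT; rewrite -dvdn2 => N_even.
by have [] := hN 2 isT N_even.
Qed.

(** The totient of [q ^ e] is [2 * ((q - 1) / 2) * q ^ (e - 1)], whose last two factors are coprime
    divisors of [N]. *)
Lemma closed_euler (N q a : nat) : closed_number N -> prime q -> q %| N ->
  coprime a q -> a ^ (2 * N) = 1 %[mod N`_q].
Proof.
move=> [N_gt0 hN] q_pr qN aq; have [q3 mN] := hN _ q_pr qN.
have e_gt0 : 0 < logn q N by rewrite logn_gt0 mem_primes q_pr N_gt0.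
have phi_dvd : totient N`_q %| 2 * N.
  rewrite p_part totient_pfactor // -subn1.
  have -> : q - 1 = 2 * ((q - 1) %/ 2) by lia.
  rewrite -mulnA dvdn_pmul2l // Gauss_dvd.
    rewrite mN (dvdn_trans _ (dvdn_part q N)) // p_part.
    by rewrite dvdn_exp2l // leq_pred.
  apply: coprimeXr; rewrite coprime_sym prime_coprime //.
  by apply/negP => /dvdn_leq; lia.
have /dvdnP[k ->] := phi_dvd; rewrite mulnC expnM -modnXm Euler_exp_totient.
  by rewrite modnXm exp1n.
by rewrite p_part coprimeXr.
Qed.

Lemma closed_novak (N : nat) : closed_number N -> novak N.
Proof.
move=> cN; have N_odd := closed_odd _ cN; have [N_gt0 hN] := cN.
split=> //; apply/dvdn_partP => // q; rewrite mem_primes => /and3P[q_pr _ qN].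
have [q3 mN] := hN _ q_pr qN.
have q_dvd : q %| 2 ^ N + 1.
  (* [N] is an odd multiple of [(q - 1) / 2], so the residue -1 persists. *)
  have /dvdnP[k kE] := mN; rewrite {1}kE mulnC expnM.
  apply: dvdn_exp_odd_succ; last exact: prime_3mod8_dvd.
  by move: N_odd; rewrite kE oddM => /andP[].
have q2 : coprime 2 q by rewrite coprime2n; apply: dvdn_odd N_odd.
have /eqP := closed_euler _ _ _ cN q_pr qN q2.
rewrite eqn_mod_dvd ?expn_gt0 // mulnC expnM -[1 in X in _ %| X](exp1n 2) subn_sqr.
rewrite Gauss_dvdr // p_part coprimeXl // prime_coprime //.
apply/negP => q_dvd'; have := dvdn_sub q_dvd q_dvd'.
have -> : 2 ^ N + 1 - (2 ^ N - 1) = 2 by have := expn_gt0 2 N; lia.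
by move=> /dvdn_leq; have := prime_gt1 q_pr; lia.
Qed.

Lemma closed_novak_carmichael (N : nat) : closed_number N ->
  novak_carmichael (2 * N).
Proof.
move=> cN; have N_odd := closed_odd _ cN; have [N_gt0 hN] := cN.
split=> [|a]; first by rewrite muln_gt0.
move=> a_cop.
have {}a_cop : coprime `|a|%N (2 * N) by [].
(* The exponent is even, so the sign of [a] is irrelevant. *)
have -> : (a ^+ (2 * N) = `|a|%N%:Z ^+ (2 * N))%R.
  by rewrite !exprM abszE real_normK ?num_real.
move: `|a|%N a_cop => {}a; rewrite coprimeMr => /andP[a2 aN].
have a_gt0 : 0 < a by case: a a2 {aN}.
have -> : (a%:Z ^+ (2 * N) - 1 = (a ^ (2 * N) - 1)%:Z)%R.
  by rewrite -[Posz a]natz -[Posz (_ - _)]natz natrB ?expn_gt0 ?a_gt0 // natrX.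
rewrite dvdzE !absz_nat Gauss_dvd ?coprime2n //; apply/andP; split.
  by rewrite dvdn2 oddB ?expn_gt0 ?a_gt0 // oddX -coprimen2 a2 orbT.
apply/dvdn_partP => // q; rewrite mem_primes => /and3P[q_pr _ qN].
rewrite -eqn_mod_dvd ?expn_gt0 ?a_gt0 //; apply/eqP.
by apply: closed_euler => //; apply: coprime_dvdr aN.
Qed.

Lemma closed_P_ (N n q : nat) : closed_number N -> prime q -> q %| N -> P_ n q.
Proof.
move=> [_ hN]; elim: n q => [|n IHn] q q_pr qN /=; have [q3 mN] := hN _ q_pr qN.
  by split.
by split=> [|r r_pr rm]; apply: IHn => //; apply: dvdn_trans mN.
Qed.

(** * Building closed multiples *)

Lemma closed_multiple (m : nat) : 0 < m ->
  (forall q, prime q -> q %| m -> P_infty q) ->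
  exists2 N, closed_number N & m %| N.
Proof.
elim/ltn_ind: m => m IHm m_gt0 hm.
have [m_le1|m_gt1] := leqP m 1.
  exists 1; last by rewrite dvdn1; lia.
  by split=> // q q_pr; rewrite dvdn1 => /eqP q1; rewrite q1 in q_pr.
have q_pr := pdiv_prime m_gt1; have q_dvd := pdiv_dvd m.
move: (pdiv m) q_pr q_dvd => q q_pr q_dvd.
have q_gt1 := prime_gt1 q_pr; have q_le := dvdn_leq m_gt0 q_dvd.
have Pq := hm _ q_pr q_dvd; have [_ q3] := Pq 0; rewrite [RHS]modn_small // in q3.
have [||r r_pr rq n|N1 cN1 qN1] := IHm ((q - 1) %/ 2); first by lia.
- by lia.
- by have [_] := Pq n.+1; apply.
have /dvdnP[m' mE] := q_dvd.
have m'_gt0 : 0 < m' by case: m' mE; lia.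
have [||r r_pr rm'|N2 cN2 mN2] := IHm m' => //; first by rewrite mE ltn_Pmulr.
  by apply: hm => //; rewrite mE dvdn_mulr.
have [N_gt0 hN] := closed_numberM _ _ cN1 cN2.
(* [N1] absorbs [(q - 1) / 2] and [N2] absorbs [m / q]; the only possibly new prime [q] has its
   condition met by [N1]. *)
exists (q * (N1 * N2)); last first.
  by rewrite mE mulnC dvdn_pmul2l ?dvdn_mull //; lia.
split=> [|r r_pr]; first by rewrite muln_gt0 N_gt0; lia.
rewrite Euclid_dvdM // => /orP[|/(hN _ r_pr)[-> d]]; last first.
  by split=> //; apply: dvdn_mull.
rewrite dvdn_prime2 // => /eqP ->; split=> //.
by apply: dvdn_mull; apply: dvdn_mulr.
Qed.

Theorem theorem7 (p : nat) (hp : prime p) :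
  (exists N : nat, novak N /\ novak_carmichael (2 * N) /\ p %| N) <-> P_infty p.
Proof.
split=> [[N [nN [ncN pN]]] n|Pp].
  exact: closed_P_ (novak_closed _ nN ncN) hp pN.
have [|q q_pr|N cN pN] := closed_multiple p; first exact: prime_gt0.
  by rewrite dvdn_prime2 // => /eqP ->.
exists N; split; first exact: closed_novak.
by split=> //; apply: closed_novak_carmichael.
Qed.
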